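(* Let a skew left brace $H$ act on an abelian group $I$ via a good triplet of actions $(\nu,\mu,\sigma)$. Then there exists a group homomorphism $$\Psi:\mathrm{H}^2_{Sb}(H,I)\to \mathrm{H}^2_{Gp}(\Lambda_H,I\times I),\qquad \Psi([(\beta,\tau)])=[(\phi_{(\beta,\tau)},\overline{\tau})],$$ where $\Lambda_H$ acts on $I\times I$ via $\chi$. Moreover, if $\mu$ is trivial (i.e. $\mu_h=\mathrm{id}$ for all $h\in H$) and $\nu_h^{-1}=\sigma_h$ for all $h\in H$, then $\Psi$ is injective.
   Context: A skew left brace is a set $H$ with two group structures $(H,+)$ (not necessarily abelian) and $(H,\circ)$ such that $a\circ(b+c)=(a\circ b)-a+(a\circ c)$ for all $a,b,c$; the two identities coincide and are denoted $0$. Put $\lambda_a(b)=-a+(a\circ b)$; then $\lambda:(H,\circ)\to\mathrm{Aut}(H,+)$ is a homomorphism. $\Lambda_H=(H,+)\rtimes_\lambda(H,\circ)$ is the group on $H\times H$ with product $(x_1,y_1)(x_2,y_2)=(x_1+\lambda_{y_1}(x_2),\,y_1\circ y_2)$. A skew left brace $H$ acts on an abelian group $I$ via a good triplet of actions $(\nu,\mu,\sigma)$ if $\nu:(H,\circ)\to\mathrm{Aut}(I)$ is a homomorphism, $\mu:(H,+)\to\mathrm{Aut}(I)$ and $\sigma:(H,\circ)\to\mathrm{Aut}(I)$ are anti-homomorphisms, and for all $h_1,h_2,h_3\in H$, $y\in I$: $\mu_{\lambda_{h_1}(h_3)}(y)=\nu_{h_1}(\mu_{h_3}(\nu_{h_1}^{-1}(y)))$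 and $\nu_{h_2+h_3}(\sigma_{h_2+h_3}(y))+\mu_{h_3}(y)=\mu_{h_3}(\nu_{h_2}(\sigma_{h_2}(y)))+\nu_{h_3}(\sigma_{h_3}(y))$. For a group $G$ acting on an abelian group $A$ from the right (an anti-homomorphism $G\to \mathrm{Aut}(A)$, $g\mapsto\rho_g$), normalized $2$-cocycles are maps $c:G\times G\to A$, vanishing when an argument is the identity, with $c(g_2,g_3)-c(g_1g_2,g_3)+c(g_1,g_2g_3)-\rho_{g_3}(c(g_1,g_2))=0$; coboundaries are $\theta(g_2)-\theta(g_1g_2)+\rho_{g_2}(\theta(g_1))$ with $\theta(1)=0$; $\mathrm{H}^2_{Gp}(G,A)$ is the quotient. $\mathrm{Z}^2_{Sb}(H,I)$ is the group of pairs $(\beta,\tau)$ of maps $H\times H\to I$ (vanishing when an argument is $0$) such that $\beta$ is a $2$-cocycle of $(H,+)$ with right action $\mu$, $\overline\tau(h_1,h_2):=\nu^{-1}_{h_1\circ h_2}(\tau(h_1,h_2))$ is a $2$-cocycle of $(H,\circ)$ with right action $\sigma$, and for all $h_1,h_2,h_3\in H$ $$\mu_{\lambda_{h_1}(h_3)}(\tau(h_1,h_2))-\tau(h_1,h_2+h_3)+\tau(h_1,h_3)=\nu_{h_1}(\beta(h_2,h_3))+\mu_{h_1\circ h_3}(\beta(h_1,-h_1))-\beta(-h_1,h_1\circ h_3)-\beta(h_1\circ h_2,\lambda_{h_1}(h_3)).$$ Two pairs $(\beta_1,\tau_1),(\beta_2,\tau_2)$ are cohomologous if there is $\theta:H\to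 I$ with $\theta(0)=0$ such that $(\beta_1-\beta_2)(h_1,h_2)=\theta(h_2)-\theta(h_1+h_2)+\mu_{h_2}(\theta(h_1))$ and $(\tau_1-\tau_2)(h_1,h_2)=\nu_{h_1}(\theta(h_2))-\theta(h_1\circ h_2)+\nu_{h_1\circ h_2}(\sigma_{h_2}(\nu_{h_1}^{-1}(\theta(h_1))))$. $\mathrm{H}^2_{Sb}(H,I)$ is the group of cohomology classes. $\Lambda_H$ acts from the right on $I\times I$ by $\chi_{(h,g)}(x,y)=\big(\nu_g^{-1}(\mu_h(x-y))+\nu_g^{-1}(\nu_h(\sigma_h(y))),\ \sigma_g(y)\big)$. For $(\beta,\tau)\in\mathrm{Z}^2_{Sb}(H,I)$, the map $(\phi_{(\beta,\tau)},\overline\tau):\Lambda_H\times\Lambda_H\to I\times I$ is $$\big((h_1,g_1),(h_2,g_2)\big)\mapsto\Big(\nu^{-1}_{g_1\circ g_2}\big(\beta(h_1,\lambda_{g_1}(h_2))+f(g_1,h_2)\big),\ \nu^{-1}_{g_1\circ g_2}(\tau(g_1,g_2))\Big),$$ with $f(g_1,h_2)=\beta(-g_1,g_1\circ h_2)-\mu_{g_1\circ h_2}(\beta(g_1,-g_1))+\tau(g_1,h_2)$. *)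

(* Defs.v *)
From HB Require Import structures.
From mathcomp Require Import all_boot all_algebra ring_quotient.
From mathcomp Require Import boolp functions.

Set Implicit Arguments.
Unset Strict Implicit.
Unset Printing Implicit Defensive.

Import Algebra GRing.Theory.

Local Open Scope ring_scope.
Local Open Scope group_scope.
Local Open Scope quotient_scope.

(* Group products inside sums, whose operands are parsed in [ring_scope]. *)
Reserved Notation "a \circ b" (at level 40, left associativity).
Notation "a \circ b" := (monoid.mul a b).

(** * Skew left braces *)

(* The group structure given by [Group] is (H, \circ). *)
HB.mixin Record isSkewBrace H of Group H := {
  sbadd : H -> H -> H;
  sbzero : H;
  sbopp : H -> H;
  sbadd_assoc : associative sbadd;
  sbadd_zero : left_id sbzero sbadd;
  sbadd_opp : left_inverse sbzero sbopp sbadd;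
  sbmul_add : forall a b c : H,
    a * sbadd b c = sbadd (sbadd (a * b) (sbopp a)) (a * c)
}.

#[short(type="skewBraceType")]
HB.structure Definition SkewBrace := {H of isSkewBrace H & Group H}.

(* The notations [a + b], [0] and [- a] for (H, +).  These structures consist of
   operations only; in particular nothing here makes [+] commutative. *)
HB.instance Definition _ (H : skewBraceType) := hasAdd.Build H (@sbadd H).
HB.instance Definition _ (H : skewBraceType) := hasZero.Build H (@sbzero H).
HB.instance Definition _ (H : skewBraceType) := hasOpp.Build H (@sbopp H).

(* (H, +), with its group law written multiplicatively. *)
Definition addg (H : Type) : Type := H.

Section AddGroup.
Variable H : skewBraceType.
Implicit Types a b c : H.

Lemma sbaddA : associative (@add H). Proof. exact: sbadd_assoc. Qed.
Lemma sbadd0r : left_id 0 (@add H). Proof. exact: sbadd_zero. Qed.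
Lemma sbaddNr : left_inverse 0 (@opp H) (@add H).
Proof. exact: sbadd_opp. Qed.
Lemma sbmulDr a b c : a \circ (b + c) = a \circ b - a + a \circ c.
Proof. exact: sbmul_add. Qed.

Lemma sbaddrN : right_inverse 0 (@opp H) (@add H).
Proof.
move=> a; rewrite -[LHS]sbadd0r -{1}(sbaddNr (- a)).
by rewrite -sbaddA (sbaddA (- a)) sbaddNr sbadd0r sbaddNr.
Qed.

Lemma sbaddr0 : right_id 0 (@add H).
Proof. by move=> a; rewrite -(sbaddNr a) sbaddA sbaddrN sbadd0r. Qed.

Lemma sbaddKr a b : - a + (a + b) = b.
Proof. by rewrite sbaddA sbaddNr sbadd0r. Qed.

Lemma sbaddNKr a b : a + (- a + b) = b.
Proof. by rewrite sbaddA sbaddrN sbadd0r. Qed.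

Lemma sbaddrI a b c : a + b = a + c -> b = c.
Proof. by move=> abc; rewrite -(sbaddKr a b) abc sbaddKr. Qed.

HB.instance Definition _ := Choice.on (addg H).
HB.instance Definition _ := isGroup.Build (addg H)
  sbaddA sbadd0r sbaddr0 sbaddNr sbaddrN.

(* The two identities coincide. *)
Lemma sb1E : 1 = 0 :> H.
Proof.
have := sbmulDr (1%g : H) 0 0; rewrite !mul1g !sbaddr0 sbadd0r => e.
by apply: (@sbaddrI (- (1%g : H))); rewrite sbaddNr sbaddr0 e.
Qed.

Definition lambda (a b : H) : H := - a + a \circ b.

Lemma lambdaK a b : a + lambda a b = a \circ b.
Proof. exact: sbaddNKr. Qed.

Lemma lambdaD a : {morph lambda a : b c / b + c}.
Proof. by move=> b c; rewrite /lambda sbmulDr !sbaddA. Qed.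

Lemma lambda1 b : lambda 1 b = b.
Proof. by apply: (@sbaddrI 1); rewrite lambdaK mul1g sb1E sbadd0r. Qed.

Lemma lambdaM a b c : lambda (a * b) c = lambda a (lambda b c).
Proof.
apply: (@sbaddrI (a * b)); rewrite lambdaK -[in RHS](lambdaK a b) -sbaddA.
by rewrite -lambdaD !lambdaK mulgA.
Qed.

Lemma lambda0r a : lambda a 0 = 0.
Proof. by rewrite /lambda -sb1E mulg1 sbaddNr sb1E. Qed.

End AddGroup.

(** * The group (H, +) \rtimes_\lambda (H, \circ) *)

Definition Lambda (H : skewBraceType) : Type := (H * H)%type.

Section LambdaGroup.
Variable H : skewBraceType.

Definition Lambda_one : Lambda H := (0, 1).
Definition Lambda_mul (p q : Lambda H) : Lambda H :=
  (p.1 + lambda p.2 q.1, p.2 * q.2).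
Definition Lambda_inv (p : Lambda H) : Lambda H :=
  (lambda p.2^-1 (- p.1), p.2^-1).

Fact Lambda_mulA : associative Lambda_mul.
Proof.
move=> p q r; congr pair => /=; last by rewrite mulgA.
by rewrite lambdaD -lambdaM sbaddA.
Qed.

Fact Lambda_mul1g : left_id Lambda_one Lambda_mul.
Proof. by case=> h g; rewrite /Lambda_mul /= lambda1 sbadd0r mul1g. Qed.

Fact Lambda_mulg1 : right_id Lambda_one Lambda_mul.
Proof. by case=> h g; rewrite /Lambda_mul /= lambda0r sbaddr0 mulg1. Qed.

Fact Lambda_mulVg : left_inverse Lambda_one Lambda_inv Lambda_mul.
Proof.
by case=> h g; rewrite /Lambda_mul /= -lambdaD sbaddNr lambda0r mulVg.
Qed.

Fact Lambda_mulgV : right_inverse Lambda_one Lambda_inv Lambda_mul.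
Proof.
by case=> h g; rewrite /Lambda_mul /= -lambdaM mulgV lambda1 sbaddrN.
Qed.

HB.instance Definition _ := Choice.copy (Lambda H) (H * H)%type.
HB.instance Definition _ := isGroup.Build (Lambda H)
  Lambda_mulA Lambda_mul1g Lambda_mulg1 Lambda_mulVg Lambda_mulgV.

End LambdaGroup.

(** * The automorphism group of an abelian group *)

Record zaut (A : zmodType) := ZAut {
  zaut_fun :> A -> A;
  zaut_inv : A -> A;
  zaut_morph : zmod_morphism zaut_fun;
  zautK : cancel zaut_fun zaut_inv;
  zautVK : cancel zaut_inv zaut_fun
}.

Section ZautGroup.
Variable A : zmodType.
Implicit Types f g : zaut A.

HB.instance Definition _ f := isZmodMorphism.Build A A f (zaut_morph f).

Lemma zautP f g : f =1 g -> f = g.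
Proof.
case: f g => f f' fB fK f'K [g g' gB gK g'K] /= /funext fg.
rewrite {f}fg in fB fK f'K *.
have f'g' : f' = g' by apply/funext => x; rewrite -[x in LHS]g'K fK.
by rewrite {f'}f'g' in fK f'K *; congr ZAut; exact: Prop_irrelevance.
Qed.

Definition zaut_one : zaut A :=
  @ZAut A id id (fun _ _ => erefl) (fun _ => erefl) (fun _ => erefl).

Fact zaut_mul_morph f g : zmod_morphism (f \o g).
Proof. by move=> x y /=; rewrite !raddfB. Qed.

Definition zaut_mul f g : zaut A :=
  ZAut (@zaut_mul_morph f g) (can_comp (zautK f) (zautK g))
       (can_comp (zautVK g) (zautVK f)).

Fact zaut_inv_morph f : zmod_morphism (zaut_inv f).
Proof.
by move=> x y; apply: (can_inj (zautK f)); rewrite (zaut_morph f) !zautVK.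
Qed.

Definition zaut_invg f : zaut A :=
  ZAut (@zaut_inv_morph f) (zautVK f) (zautK f).

Fact zaut_mulA : associative zaut_mul.
Proof. by move=> f g h; apply: zautP. Qed.
Fact zaut_mul1g : left_id zaut_one zaut_mul.
Proof. by move=> f; apply: zautP. Qed.
Fact zaut_mulg1 : right_id zaut_one zaut_mul.
Proof. by move=> f; apply: zautP. Qed.
Fact zaut_mulVg : left_inverse zaut_one zaut_invg zaut_mul.
Proof. by move=> f; apply: zautP => x /=; exact: zautK. Qed.
Fact zaut_mulgV : right_inverse zaut_one zaut_invg zaut_mul.
Proof. by move=> f; apply: zautP => x /=; exact: zautVK. Qed.

HB.instance Definition _ := gen_eqMixin (zaut A).
HB.instance Definition _ := gen_choiceMixin (zaut A).
HB.instance Definition _ := isGroup.Build (zaut A)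
  zaut_mulA zaut_mul1g zaut_mulg1 zaut_mulVg zaut_mulgV.

Lemma zaut1E x : (1 : zaut A) x = x. Proof. by []. Qed.
Lemma zautME f g x : (f * g) x = f (g x). Proof. by []. Qed.
Lemma zaut0 f : f 0 = 0. Proof. exact: raddf0. Qed.
Lemma zautD f : {morph f : x y / x + y}. Proof. exact: raddfD. Qed.
Lemma zautB f : {morph f : x y / x - y}. Proof. exact: raddfB. Qed.
Lemma zautKE f x : f^-1 (f x) = x. Proof. exact: zautK. Qed.
Lemma zautVKE f x : f (f^-1 x) = x. Proof. exact: zautVK. Qed.

End ZautGroup.

(* Right actions, i.e. anti-homomorphisms G -> Aut(A). *)
Record rightAction (G : groupType) (A : zmodType) := RightAction {
  ract :> G -> zaut A;
  ractM : forall g h : G, ract (g * h) = ract h * ract g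
}.

Lemma ract1 (G : groupType) (A : zmodType) (r : rightAction G A) : r 1 = 1.
Proof. by apply: (@mulgI _ (r 1)); rewrite -ractM !mulg1. Qed.

(** * Second cohomology of groups *)

Lemma fun2B (X Y : Type) (A : zmodType) (c d : X -> Y -> A) x y :
  (c - d) x y = c x y - d x y.
Proof. by []. Qed.

Lemma fun1B (X : Type) (A : zmodType) (c d : X -> A) x : (c - d) x = c x - d x.
Proof. by []. Qed.

Lemma fun2_0 (X Y : Type) (A : zmodType) x y : (0 : X -> Y -> A) x y = 0.
Proof. by []. Qed.

Lemma fun1_0 (X : Type) (A : zmodType) x : (0 : X -> A) x = 0.
Proof. by []. Qed.

Lemma subrACA (A : zmodType) (x y z t : A) :
  (x - y) - (z - t) = (x - z) - (y - t).
Proof. by rewrite opprD addrACA -opprD. Qed.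

Section GroupCohomology.
Variables (G : groupType) (A : zmodType) (rho : rightAction G A).

Definition cocycle (c : G -> G -> A) : Prop :=
  (forall g, c 1 g = 0 /\ c g 1 = 0) /\
  (forall g1 g2 g3,
     c g2 g3 - c (g1 \circ g2) g3 + c g1 (g2 \circ g3) - rho g3 (c g1 g2) = 0).

Definition Z2Gp_pred (c : G -> G -> A) : bool := `[< cocycle c >].

Fact Z2Gp_zmod_closed : zmod_closed Z2Gp_pred.
Proof.
split=> [|c d /asboolP[c1 cE] /asboolP[d1 dE]]; apply/asboolP; split=> //.
- by move=> g1 g2 g3; rewrite !fun2_0 zaut0 !subr0 addr0.
- move=> g; have [c1g cg1] := c1 g; have [d1g dg1] := d1 g.
  by rewrite !fun2B c1g cg1 d1g dg1 subr0.
- move=> g1 g2 g3; rewrite -[RHS](subr0 0) -{1}(cE g1 g2 g3) -(dE g1 g2 g3).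
  by rewrite !fun2B zautB subrACA addrACA -opprD subrACA.
Qed.

HB.instance Definition _ :=
  isZmodClosed.Build (G -> G -> A) Z2Gp_pred Z2Gp_zmod_closed.

Definition Z2Gp : Type := {c : G -> G -> A | Z2Gp_pred c}.

HB.instance Definition _ := SubChoice.on Z2Gp.
HB.instance Definition _ := [SubChoice_isSubZmodule of Z2Gp by <:].

Definition B2Gp : {pred Z2Gp} := fun c =>
  `[< exists theta : G -> A, theta 1 = 0 /\
        forall g1 g2, val c g1 g2 =
          theta g2 - theta (g1 \circ g2) + rho g2 (theta g1) >].

Fact B2Gp_zmod_closed : zmod_closed B2Gp.
Proof.
split=> [|c d /asboolP[t [t1 tE]] /asboolP[u [u1 uE]]]; apply/asboolP.
  by exists 0; split=> // g1 g2; rewrite !fun1_0 zaut0 subr0 addr0.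
exists (t - u); split=> [|g1 g2]; first by rewrite fun1B t1 u1 subr0.
have -> : val (c - d) g1 g2 = val c g1 g2 - val d g1 g2 by [].
rewrite !fun1B tE uE zautB.
by rewrite [in RHS]subrACA [in RHS]addrACA -opprD.
Qed.

HB.instance Definition _ := isZmodClosed.Build Z2Gp B2Gp B2Gp_zmod_closed.

Definition H2Gp : Type := @Quotient.quot Z2Gp B2Gp.

HB.instance Definition _ := GRing.Zmodule.on H2Gp.
HB.instance Definition _ := EqQuotient.on H2Gp.

End GroupCohomology.

(** * Second cohomology of skew left braces *)

Record goodTriplet (H : skewBraceType) (I : zmodType) := GoodTriplet {
  nu : {multiplicative H -> zaut I};
  mu : rightAction (addg H) I;
  sigma : rightAction H I;
  mu_lambda : forall (h1 h3 : H) (y : I),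
    mu (lambda h1 h3) y = nu h1 (mu h3 ((nu h1)^-1%g y));
  nu_sigma_mu : forall (h2 h3 : H) (y : I),
    nu (h2 + h3) (sigma (h2 + h3) y) + mu h3 y =
    mu h3 (nu h2 (sigma h2 y)) + nu h3 (sigma h3 y)
}.

Section BraceCohomology.
Variables (H : skewBraceType) (I : zmodType) (T : goodTriplet H I).
Implicit Types (h g : H) (x y : I) (tau : H -> H -> I).

Local Notation nu := (nu T).
Local Notation mu := (mu T).
Local Notation sigma := (sigma T).

Lemma nu1 : nu 1 = 1.
Proof. by apply: (@mulgI _ (nu 1)); rewrite -gmulfM !mulg1. Qed.

Definition taubar tau : H -> H -> I :=
  fun h1 h2 => (nu (h1 * h2))^-1 (tau h1 h2).

Definition brace_cocycle (p : (H -> H -> I) * (H -> H -> I)) : Prop :=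
  let: (beta, tau) := p in
  [/\ forall h, beta 0 h = 0 /\ beta h 0 = 0,
      forall h, tau 0 h = 0 /\ tau h 0 = 0,
      cocycle mu beta,
      cocycle sigma (taubar tau)
    & forall h1 h2 h3,
        mu (lambda h1 h3) (tau h1 h2) - tau h1 (h2 + h3) + tau h1 h3 =
        nu h1 (beta h2 h3) + mu (h1 \circ h3) (beta h1 (- h1))
        - beta (- h1) (h1 \circ h3) - beta (h1 \circ h2) (lambda h1 h3)].

Definition Z2Sb_pred (p : (H -> H -> I) * (H -> H -> I)) : bool :=
  `[< brace_cocycle p >].

Lemma taubarB tau1 tau2 : taubar (tau1 - tau2) = taubar tau1 - taubar tau2.
Proof. by apply/funext => h1; apply/funext => h2; rewrite /taubar zautB. Qed.

Lemma taubar0 : taubar 0 = 0.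
Proof. by apply/funext => h1; apply/funext => h2; rewrite /taubar zaut0. Qed.

Fact Z2Sb_zmod_closed : zmod_closed Z2Sb_pred.
Proof.
split=> [|[b t] [c u] /asboolP[b0 t0 bE tE btE] /asboolP[c0 u0 cE uE cuE]].
  apply/asboolP; split=> //.
  - by apply/asboolP; exact: (Z2Gp_zmod_closed mu).1.
  - by rewrite taubar0; apply/asboolP; exact: (Z2Gp_zmod_closed sigma).1.
  - by move=> h1 h2 h3; rewrite !fun2_0 !zaut0 !subr0 !addr0.
have -> : (b, t) - (c, u) = (b - c, t - u) by [].
apply/asboolP; split.
- move=> h; have [b0h bh0] := b0 h; have [c0h ch0] := c0 h.
  by rewrite !fun2B b0h bh0 c0h ch0 subr0.
- move=> h; have [t0h th0] := t0 h; have [u0h uh0] := u0 h.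
  by rewrite !fun2B t0h th0 u0h uh0 subr0.
- by apply/asboolP; apply: (Z2Gp_zmod_closed mu).2; exact/asboolP.
- rewrite taubarB; apply/asboolP.
  by apply: (Z2Gp_zmod_closed sigma).2; exact/asboolP.
- move=> h1 h2 h3; rewrite !fun2B !zautB subrACA addrACA -opprD.
  rewrite (addrACA (nu h1 _)) -opprD [X in _ = X - _]subrACA [RHS]subrACA.
  by rewrite -btE -cuE.
Qed.

HB.instance Definition _ :=
  isZmodClosed.Build ((H -> H -> I) * (H -> H -> I))%type Z2Sb_pred
    Z2Sb_zmod_closed.

Definition Z2Sb : Type := {p : (H -> H -> I) * (H -> H -> I) | Z2Sb_pred p}.

HB.instance Definition _ := SubChoice.on Z2Sb.
HB.instance Definition _ := [SubChoice_isSubZmodule of Z2Sb by <:].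

Definition B2Sb : {pred Z2Sb} := fun z =>
  `[< exists theta : H -> I, theta 0 = 0 /\
        forall h1 h2,
          (val z).1 h1 h2 =
            theta h2 - theta (h1 + h2) + mu h2 (theta h1) /\
          (val z).2 h1 h2 =
            nu h1 (theta h2) - theta (h1 \circ h2)
            + nu (h1 \circ h2) (sigma h2 ((nu h1)^-1%g (theta h1))) >].

Fact B2Sb_zmod_closed : zmod_closed B2Sb.
Proof.
split=> [|c d /asboolP[t [t0 tE]] /asboolP[u [u0 uE]]]; apply/asboolP.
  by exists 0; split=> // h1 h2; rewrite !fun1_0 !zaut0 !subr0 !addr0.
exists (t - u); split=> [|h1 h2]; first by rewrite fun1B t0 u0 subr0.
have [t1 t2] := tE h1 h2; have [u1 u2] := uE h1 h2.
have -> : val (c - d) = ((val c).1 - (val d).1, (val c).2 - (val d).2) by [].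
rewrite [(_, _).1]/= [(_, _).2]/= !fun2B !fun1B t1 t2 u1 u2 !zautB.
split; first by rewrite [X in _ = X + _]subrACA [RHS]addrACA -opprD.
by rewrite [X in _ = X + _]subrACA [RHS]addrACA -opprD.
Qed.

HB.instance Definition _ := isZmodClosed.Build Z2Sb B2Sb B2Sb_zmod_closed.

Definition H2Sb : Type := @Quotient.quot Z2Sb B2Sb.

HB.instance Definition _ := GRing.Zmodule.on H2Sb.
HB.instance Definition _ := EqQuotient.on H2Sb.

(** * The action \chi and the map \phi *)

Definition chi_fun (p : Lambda H) (z : I * I) : I * I :=
  let: (h, g) := p in
  let: (x, y) := z in
  ((nu g)^-1%g (mu h (x - y)) + (nu g)^-1%g (nu h (sigma h y)), sigma g y).

Fact chi_funB p : zmod_morphism (chi_fun p).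
Proof.
case: p => h g [x1 y1] [x2 y2]; congr pair; last by rewrite zautB.
pose F x y := (nu g)^-1%g (mu h (x - y)) + (nu g)^-1%g (nu h (sigma h y)).
rewrite -[LHS]/(F (x1 - x2) (y1 - y2)) -[RHS]/(F x1 y1 - F x2 y2) /F !zautB.
by rewrite [X in X + _ = _]subrACA [LHS]addrACA -[in LHS]opprD.
Qed.

Fact chi_fun1 z : chi_fun 1 z = z.
Proof.
case: z => x y.
rewrite -[LHS]/((nu 1%g)^-1%g (mu 0 (x - y)) +
                (nu 1%g)^-1%g (nu 0 (sigma 0 y)), sigma 1%g y).
have -> : mu 0 = 1%g by exact: ract1 mu.
by rewrite -sb1E nu1 ract1 invg1 !zaut1E subrK.
Qed.

Fact chi_funM p q z : chi_fun (p * q) z = chi_fun q (chi_fun p z).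
Proof.
case: p q z => h1 g1 [h2 g2] [x y]; set k := lambda g1 h2.
have muD h h' w : mu (h + h') w = mu h' (mu h w).
  by have -> : mu (h + h') = (mu h' * mu h)%g by exact: (ractM mu h h').
have muk w : (nu g1)^-1%g (mu k w) = mu h2 ((nu g1)^-1%g w).
  by rewrite mu_lambda zautKE.
have nsD h h' w : nu (h + h') (sigma (h + h') w) =
    mu h' (nu h (sigma h w)) + nu h' (sigma h' w) - mu h' w.
  by rewrite -nu_sigma_mu addrK.
have key : (nu g1)^-1%g (nu k (sigma k y)) - mu h2 ((nu g1)^-1%g y) =
    nu h2 (sigma h2 (sigma g1 y)) - mu h2 (sigma g1 y).
  have := congr1 (nu g1)^-1%g (nsD g1 k y).
  rewrite {1 2}/k lambdaK gmulfM ractM !zautME zautKE => ->.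
  rewrite zautB zautD !muk zautKE -[in RHS](addrA (mu h2 _)).
  by rewrite [RHS]addrAC subrr add0r.
congr pair; last by rewrite ractM.
set x' := (nu g1)^-1%g (mu h1 (x - y)) + (nu g1)^-1%g (nu h1 (sigma h1 y)).
rewrite -[LHS]/((nu (g1 * g2))^-1%g (mu (h1 + k) (x - y)) +
  (nu (g1 * g2))^-1%g (nu (h1 + k) (sigma (h1 + k) y))).
rewrite -[RHS]/((nu g2)^-1%g (mu h2 (x' - sigma g1 y)) +
  (nu g2)^-1%g (nu h2 (sigma h2 (sigma g1 y)))).
rewrite gmulfM invgM !zautME -[LHS]zautD -[RHS]zautD; congr (_ _).
rewrite muD nsD /x' [X in _ + X = _]zautB [in X in _ + X = _]zautD !muk -addrA key.
rewrite [X in _ = X + _]zautB [X in _ = X - _ + _]zautD !addrA.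
by rewrite addrAC.
Qed.

Fact chiK p : cancel (chi_fun p) (chi_fun p^-1).
Proof. by move=> z; rewrite -chi_funM mulgV chi_fun1. Qed.

Fact chiVK p : cancel (chi_fun p^-1) (chi_fun p).
Proof. by move=> z; rewrite -chi_funM mulVg chi_fun1. Qed.

Definition chi_aut (p : Lambda H) : zaut (I * I)%type :=
  ZAut (@chi_funB p) (chiK p) (chiVK p).

Fact chi_autM p q : chi_aut (p * q) = chi_aut q * chi_aut p.
Proof. by apply: zautP => z; exact: chi_funM. Qed.

Definition chi : rightAction (Lambda H) (I * I)%type := RightAction chi_autM.

Definition phi_f (beta tau : H -> H -> I) (g1 h2 : H) : I :=
  beta (- g1) (g1 \circ h2) - mu (g1 \circ h2) (beta g1 (- g1)) + tau g1 h2.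

Definition phi (p : (H -> H -> I) * (H -> H -> I)) :
    Lambda H -> Lambda H -> I * I :=
  let: (beta, tau) := p in
  fun a b => let: (h1, g1) := a in let: (h2, g2) := b in
  ((nu (g1 * g2))^-1%g (beta h1 (lambda g1 h2) + phi_f beta tau g1 h2),
   taubar tau g1 g2).

End BraceCohomology.

Arguments B2Gp {G A} rho.
Arguments B2Sb {H I} T.

(* Main.v *)
(* A pair (beta, tau) encodes an extension E of H by I with representatives s h:
   beta and taubar measure the failure of s to respect + and \circ.  Then
   Lambda E is an extension of Lambda H by I * I, with representatives
   (s h, s g), and its 2-cocycle is (phi, taubar).  The I-part of
   lambda (s g) (s h) is f(g, h) = tau(g, h) - beta(g, lambda_g(h)), and the
   cocycle identity of phi reduces to the additivity and multiplicativity of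
   lambda, i.e. to two identities on f.  A cochain theta bounding (beta, tau)
   gives (h, g) |-> (nu_g^-1 (theta h), nu_g^-1 (theta g)) bounding phi. *)
Require Import Defs.
From HB Require Import structures.
From mathcomp Require Import all_boot all_algebra ring_quotient.
From mathcomp Require Import boolp functions.

Set Implicit Arguments.
Unset Strict Implicit.
Unset Printing Implicit Defensive.

Import Algebra GRing.Theory.

Local Open Scope ring_scope.
Local Open Scope group_scope.
Local Open Scope quotient_scope.

(** * Linear arithmetic in abelian groups *)

(** Adds a known equation to the goal. Successive uses form a linear combination, and [zmod_eq]
    checks that what remains is an identity. *)
Lemma eq_add_cancel (A : zmodType) (u v x y : A) :
  u = v -> x + v = y + u -> x = y.
Proof. by move=> ->; exact: addIr. Qed.

(* Decides equality in a [zmodType] up to associativity, commutativity and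
   cancellation: the leading term of a null sum is carried rightwards until it
   meets its opposite. *)
Ltac cancel_head x :=
  first [ rewrite (addKr x) | rewrite (addNKr x) | rewrite (subrr x)
        | rewrite (addNr x)
        | match x with - ?y =>
            first [ rewrite (addKr y) | rewrite (addNr y) ] end
        | rewrite (addrCA x); cancel_head x ].

Ltac zmod_eq :=
  apply/eqP; rewrite -subr_eq0; apply/eqP;
  rewrite ?(opprD, opprK, oppr0, addr0, add0r) -?addrA;
  repeat match goal with |- ?x + _ = 0 =>
    cancel_head x; rewrite ?(addr0, add0r) end;
  try reflexivity.

Section Cocycle.
Variables (H : skewBraceType) (I : zmodType) (T : goodTriplet H I).
Implicit Types (h g k l : H) (x y : I).

Local Notation nu := (nu T).
Local Notation mu := (mu T).
Local Notation sigma := (sigma T).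

(** * Interaction of [nu] with the other actions *)

Lemma nuM g h x : nu (g \circ h) x = nu g (nu h x).
Proof. by rewrite gmulfM zautME. Qed.

Lemma nuMK g h x : nu (g \circ h) ((nu h)^-1%g x) = nu g x.
Proof. by rewrite nuM zautVKE. Qed.

Lemma nu_mu g h x : nu g (mu h x) = mu (lambda g h) (nu g x).
Proof. by rewrite mu_lambda zautKE. Qed.

(** Clears the inverses from the first component of [chi] once an identity has been transported by
    [nu]. *)
Lemma nu_chi g k h x y :
  nu (g \circ k) ((nu k)^-1%g (mu h (x - y)) + (nu k)^-1%g (nu h (sigma h y))) =
  mu (lambda g h) (nu g x - nu g y) + nu (g \circ h) (sigma h y).
Proof. by rewrite zautD !nuMK nu_mu zautB -nuM. Qed.

Lemma nu_taubar (tau : H -> H -> I) g h :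
  nu (g \circ h) (taubar T tau g h) = tau g h.
Proof. exact: zautVKE. Qed.

(** * Consequences of the cocycle conditions on [(beta, tau)] *)

Section BraceCocycle.
Variables beta tau : H -> H -> I.
Hypothesis bt : brace_cocycle T (beta, tau).

Lemma beta0h h : beta 0 h = 0. Proof. by case: bt => b _ _ _ _; case: (b h). Qed.
Lemma betah0 h : beta h 0 = 0. Proof. by case: bt => b _ _ _ _; case: (b h). Qed.
Lemma tau0h h : tau 0 h = 0. Proof. by case: bt => _ b _ _ _; case: (b h). Qed.
Lemma tauh0 h : tau h 0 = 0. Proof. by case: bt => _ b _ _ _; case: (b h). Qed.

Lemma beta_cocycle h k l :
  beta k l + beta h (k + l) = beta (h + k) l + mu l (beta h k).
Proof.
case: bt => _ _ [_ /(_ h k l) E] _ _.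
have {}E : beta k l - beta (h + k) l + beta h (k + l) - mu l (beta h k) = 0.
  exact: E.
by apply: (eq_add_cancel E); zmod_eq.
Qed.

Lemma tau_cocycle g h k :
  nu g (tau h k) + tau g (h \circ k) =
  tau (g \circ h) k + nu (g \circ h \circ k) (sigma k (taubar T tau g h)).
Proof.
case: bt => _ _ _ [_ /(_ g h k) E] _.
have {}E : taubar T tau h k - taubar T tau (g \circ h) k
    + taubar T tau g (h \circ k) - sigma k (taubar T tau g h) = 0 by exact: E.
rewrite -!(nu_taubar tau) -nuM !mulgA -!zautD; congr (nu _ _).
by apply: (eq_add_cancel E); zmod_eq.
Qed.

(** The cocycle identity of [beta] at [g], [- g], [g \circ h], whose first two arguments add up to
    [0]. *)
Lemma phi_fE g h : phi_f T beta tau g h = tau g h - beta g (lambda g h).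
Proof.
have := beta_cocycle g (- g) (g \circ h).
rewrite sbaddrN beta0h -/(lambda g h) => E.
by rewrite /phi_f; apply: (eq_add_cancel E); zmod_eq.
Qed.

(** By [phi_fE], the two terms of the compatibility condition that involve [- g] collapse to
    [beta g (lambda g k)]. *)
Lemma beta_tau_compat g h k :
  mu (lambda g k) (tau g h) - tau g (h + k) + tau g k =
  nu g (beta h k) + beta g (lambda g k) - beta (g \circ h) (lambda g k).
Proof.
case: bt => _ _ _ _ /(_ g h k) E.
have := phi_fE g k; rewrite /phi_f => F.
by rewrite E; apply: (eq_add_cancel (esym F)); zmod_eq.
Qed.

(* Lifting [H] to a set of representatives [s], [phi_f g h] is the [I]-part of
   [lambda (s g) (s h)]; this is the additivity of [lambda (s g)]. *)
Lemma phi_fD g h k :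
  nu g (beta h k) + phi_f T beta tau g (h + k) =
  beta (lambda g h) (lambda g k) + mu (lambda g k) (phi_f T beta tau g h)
  + phi_f T beta tau g k.
Proof.
rewrite !phi_fE zautB.
have E := beta_tau_compat g h k.
have F := beta_cocycle g (lambda g h) (lambda g k).
rewrite lambdaK -lambdaD in F.
by apply: (eq_add_cancel (esym E)); apply: (eq_add_cancel (esym F)); zmod_eq.
Qed.

(* Multiplicativity of [lambda]: [s g1 \circ s g2] and [s (g1 \circ g2)] differ
   by [taubar g1 g2], whose own [lambda] yields the two terms in [tau]. *)
Lemma phi_fM g1 g2 h :
  nu g1 (phi_f T beta tau g2 h) + phi_f T beta tau g1 (lambda g2 h)
  + mu (lambda (g1 \circ g2) h) (tau g1 g2) =
  phi_f T beta tau (g1 \circ g2) h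
  + nu (g1 \circ g2 \circ h) (sigma h (taubar T tau g1 g2)).
Proof.
rewrite !phi_fE zautB lambdaM.
have E := beta_tau_compat g1 g2 (lambda g2 h); rewrite lambdaK in E.
have F := tau_cocycle g1 g2 h.
by apply: (eq_add_cancel E); apply: (eq_add_cancel F); zmod_eq.
Qed.

(** * Cocycles and coboundaries on [Lambda H] *)

Lemma phiE h1 g1 h2 g2 : phi T (beta, tau) (h1, g1) (h2, g2) =
  ((nu (g1 \circ g2))^-1%g
     (beta h1 (lambda g1 h2) + phi_f T beta tau g1 h2), taubar T tau g1 g2).
Proof. by []. Qed.

Lemma phi_cocycle : cocycle (chi T) (phi T (beta, tau)).
Proof.
split=> [[h g] | [h1 g1] [h2 g2] [h3 g3]].
  split; rewrite -[1%g]/(0, 1%g) phiE; congr pair.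
  - by rewrite phi_fE sb1E beta0h tau0h subr0 addr0 zaut0.
  - by rewrite /taubar sb1E tau0h zaut0.
  - by rewrite phi_fE lambda0r !betah0 tauh0 subr0 addr0 zaut0.
  - by rewrite /taubar sb1E tauh0 zaut0.
congr pair; last by case: bt => _ _ _ [_ /(_ g1 g2 g3) E] _; exact: E.
set u := taubar T tau g1 g2.
pose F h g k := beta h (lambda g k) + phi_f T beta tau g k.
suff E : (nu (g2 \circ g3))^-1%g (F h2 g2 h3)
    - (nu (g1 \circ g2 \circ g3))^-1%g (F (h1 + lambda g1 h2) (g1 \circ g2) h3)
    + (nu (g1 \circ (g2 \circ g3)))^-1%g (F h1 g1 (h2 + lambda g2 h3))
    - ((nu g3)^-1%g (mu h3 ((nu (g1 \circ g2))^-1%g (F h1 g1 h2) - u))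
       + (nu g3)^-1%g (nu h3 (sigma h3 u))) = 0 by exact: E.
apply: (can_inj (zautK (nu (g1 \circ g2 \circ g3)))).
rewrite zautB zautD zautB zaut0 nu_chi !zautVKE -!mulgA nuMK mulgA zautVKE.
rewrite {}/F {}/u mulgA.
have D := phi_fD g1 h2 (lambda g2 h3).
have M := phi_fM g1 g2 h3.
have B := beta_cocycle h1 (lambda g1 h2) (lambda (g1 \circ g2) h3).
(* The rest follows from [D], [M] and [B] alone, so [phi_f] becomes an arbitrary function. *)
move: (phi_f T beta tau) D M B => f; rewrite lambdaD -lambdaM => D M B.
rewrite !(zautB, zautD).
apply: (eq_add_cancel D); apply: (eq_add_cancel M); apply: (eq_add_cancel B).
by zmod_eq.
Qed.

Lemma phi_coboundary (theta : H -> I) : theta 0 = 0 ->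
    (forall h k, beta h k = theta k - theta (h + k) + mu k (theta h)) ->
    (forall h k, tau h k = nu h (theta k) - theta (h \circ k)
       + nu (h \circ k) (sigma k ((nu h)^-1%g (theta h)))) ->
  exists Theta : Lambda H -> I * I, Theta 1 = 0 /\
    forall p q, phi T (beta, tau) p q =
      Theta q - Theta (p \circ q) + chi T q (Theta p).
Proof.
move=> theta0 betaE tauE.
exists (fun p => ((nu p.2)^-1%g (theta p.1), (nu p.2)^-1%g (theta p.2))).
split=> [|[h1 g1] [h2 g2]].
  by congr pair; rewrite /= ?sb1E theta0; exact: (zaut0 (nu 0)^-1%g).
set w := (nu g1)^-1%g.
suff [E1 E2] :
    (nu (g1 \circ g2))^-1%g (beta h1 (lambda g1 h2) + phi_f T beta tau g1 h2) =
      (nu g2)^-1%g (theta h2)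
      - (nu (g1 \circ g2))^-1%g (theta (h1 + lambda g1 h2))
      + ((nu g2)^-1%g (mu h2 (w (theta h1) - w (theta g1)))
         + (nu g2)^-1%g (nu h2 (sigma h2 (w (theta g1))))) /\
    taubar T tau g1 g2 = (nu g2)^-1%g (theta g2)
      - (nu (g1 \circ g2))^-1%g (theta (g1 \circ g2))
      + sigma g2 (w (theta g1)).
  by rewrite phiE E1 E2.
split; apply: (can_inj (zautK (nu (g1 \circ g2)))).
  (* The values of [theta] at [lambda g1 h2] and [g1 \circ h2] cancel among the [beta] and [tau]
     terms. *)
  rewrite [RHS]zautD zautB nu_chi nuMK !zautVKE phi_fE !betaE tauE lambdaK -/w.
  by rewrite zautB; zmod_eq.
by rewrite nu_taubar tauE zautD zautB nuMK zautVKE.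
Qed.

(* The first component [a] of a trivialization of [phi] satisfies
   [a (h, g) = a (0, g) + (nu g)^-1 (a (h, 1))], so that [h |-> a (h, 1)]
   trivializes [tau] along with [beta]. *)
Lemma brace_coboundary_of_phi (Theta : Lambda H -> I * I) :
    (forall h x, mu h x = x) -> (forall h, (nu h)^-1%g = sigma h) ->
    Theta 1 = 0 ->
    (forall p q, phi T (beta, tau) p q =
      Theta q - Theta (p \circ q) + chi T q (Theta p)) ->
  exists theta : H -> I, theta 0 = 0 /\
    forall h k, beta h k = theta k - theta (h + k) + mu k (theta h) /\
      tau h k = nu h (theta k) - theta (h \circ k)
        + nu (h \circ k) (sigma k ((nu h)^-1%g (theta h))).
Proof.
move=> mu_id nuV_sigma Theta1 ThetaE.
pose a h g := (Theta (h, g)).1.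
have aE h1 g1 h2 g2 :
    (nu (g1 \circ g2))^-1%g (beta h1 (lambda g1 h2) + phi_f T beta tau g1 h2) =
    a h2 g2 - a (h1 + lambda g1 h2) (g1 \circ g2) + (nu g2)^-1%g (a h1 g1).
  transitivity (a h2 g2 - a (h1 + lambda g1 h2) (g1 \circ g2)
    + (chi T (h2, g2) (Theta (h1, g1))).1).
    exact: (congr1 fst (ThetaE (h1, g1) (h2, g2))).
  congr (_ + _); rewrite /a; case: (Theta (h1, g1)) => x y.
  transitivity ((nu g2)^-1%g (mu h2 (x - y))
    + (nu g2)^-1%g (nu h2 (sigma h2 y))); first by [].
  (* Under the two extra assumptions [y] cancels, so the first component evolves independently of
     the second. *)
  by rewrite mu_id -nuV_sigma zautVKE -zautD subrK.
have phi_f1 h : phi_f T beta tau 1%g h = 0.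
  by rewrite phi_fE sb1E tau0h beta0h subr0.
have a_split h g : a h g = a 0 g + (nu g)^-1%g (a h 1%g).
  (* [phi] has first component [0] at the pair [(h, 1)], [(0, g)], whose product is [(h, g)]. *)
  have := aE h 1%g 0 g.
  rewrite phi_f1 lambda0r betah0 addr0 zaut0 sbaddr0 mul1g => E.
  by apply: (eq_add_cancel E); zmod_eq.
exists (fun h => a h 1%g); split; first exact: (congr1 fst Theta1).
move=> h k; split.
  (* On the copy of (H, +) formed by the pairs [(h, 1)], the first component of [phi] is [beta]. *)
  have := aE h 1%g k 1%g.
  by rewrite phi_f1 lambda1 addr0 mulg1 nu1 invg1 !zaut1E mu_id.
rewrite -nuV_sigma nuM !zautVKE; apply: (can_inj (zautK (nu h)^-1%g)).
(* With both entries equal to [h], the [beta] terms cancel and only [tau h k] survives; the product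
   is [(h \circ k, h)], and [a_split] then makes the two [a 0 h] cancel. *)
have := aE h h k 1%g.
rewrite phi_fE [beta _ _ + _]addrC subrK lambdaK mulg1 nu1 invg1 zaut1E => ->.
rewrite zautD zautB zautKE (a_split (h \circ k) h) (a_split h h).
by zmod_eq.
Qed.

End BraceCocycle.

(** * Passage to cohomology classes *)

Lemma phiB (p q : (H -> H -> I) * (H -> H -> I)) :
  phi T (p - q) = phi T p - phi T q.
Proof.
case: p q => [b t] [c u]; apply/funext => -[h1 g1]; apply/funext => -[h2 g2].
suff E : (nu (g1 \circ g2))^-1%g
    ((b - c) h1 (lambda g1 h2) + phi_f T (b - c) (t - u) g1 h2) =
    (nu (g1 \circ g2))^-1%g (b h1 (lambda g1 h2) + phi_f T b t g1 h2)
    - (nu (g1 \circ g2))^-1%g (c h1 (lambda g1 h2) + phi_f T c u g1 h2).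
  by congr pair; [exact: E | rewrite taubarB].
rewrite -zautB; congr (_ _); rewrite /phi_f !fun2B zautB.
by zmod_eq.
Qed.

Fact phi_Z2Gp (z : Z2Sb T) : Z2Gp_pred (chi T) (phi T (val z)).
Proof. by case: z => -[b t] /= /asboolP bt; apply/asboolP/phi_cocycle. Qed.

Definition Phi (z : Z2Sb T) : Z2Gp (chi T) := Sub (phi T (val z)) (phi_Z2Gp z).

Lemma val_Phi z : val (Phi z) = phi T (val z). Proof. exact: SubK. Qed.

Lemma PhiB : {morph Phi : z w / z - w}.
Proof. by move=> z w; apply: val_inj; rewrite raddfB !val_Phi raddfB phiB. Qed.

Lemma Phi_B2Gp z : z \in B2Sb T -> Phi z \in B2Gp (chi T).
Proof.
case: z => -[b t] zP; have /asboolP bt := zP.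
move=> /asboolP[theta [theta0 thetaE]]; apply/asboolP.
have [Theta [Theta1 ThetaE]] := phi_coboundary bt theta0
  (fun h k => (thetaE h k).1) (fun h k => (thetaE h k).2).
by exists Theta; split=> // p q; rewrite val_Phi ThetaE.
Qed.

Lemma B2Sb_of_Phi z :
    (forall h x, mu h x = x) -> (forall h, (nu h)^-1%g = sigma h) ->
  Phi z \in B2Gp (chi T) -> z \in B2Sb T.
Proof.
case: z => -[b t] zP mu_id nuV_sigma; have /asboolP bt := zP.
move=> /asboolP[Theta [Theta1 ThetaE]]; apply/asboolP.
apply: (brace_coboundary_of_phi bt mu_id nuV_sigma Theta1) => p q.
by rewrite -ThetaE val_Phi.
Qed.

Definition Psi (q : H2Sb T) : H2Gp (chi T) :=
  \pi_(H2Gp (chi T)) (Phi (repr q)).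

(** Independence of the chosen representative: it differs from [z] by a coboundary, which [Phi] maps
    to a coboundary. *)
Lemma Psi_pi z : Psi (\pi_(H2Sb T) z) = \pi_(H2Gp (chi T)) (Phi z).
Proof.
apply/eqP; rewrite /Psi -Quotient.idealrBE -PhiB Phi_B2Gp //.
by rewrite Quotient.idealrBE reprK.
Qed.

Fact Psi_zmod_morphism : zmod_morphism Psi.
Proof.
elim/quotW=> z; elim/quotW=> w.
by rewrite -raddfB !Psi_pi PhiB raddfB.
Qed.

HB.instance Definition _ :=
  isZmodMorphism.Build (H2Sb T) (H2Gp (chi T)) Psi Psi_zmod_morphism.

Lemma Psi_inj :
  (forall h x, mu h x = x) -> (forall h, (nu h)^-1%g = sigma h) -> injective Psi.
Proof.
move=> mu_id nuV_sigma; elim/quotW=> z; elim/quotW=> w; rewrite !Psi_pi.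
move=> /eqP; rewrite -Quotient.idealrBE -PhiB => /B2Sb_of_Phi.
by move=> /(_ mu_id nuV_sigma); rewrite Quotient.idealrBE => /eqP.
Qed.

End Cocycle.

Theorem theorem1p1 (H : skewBraceType) (I : zmodType) (T : goodTriplet H I) :
  exists Psi : {additive H2Sb T -> H2Gp (chi T)},
    (forall z : Z2Sb T,
       exists w : Z2Gp (chi T),
         val w = phi T (val z) /\
         Psi (\pi_(H2Sb T) z) = \pi_(H2Gp (chi T)) w) /\
    ((forall (h : H) (y : I), mu T h y = y) ->
     (forall h : H, (nu T h)^-1 = sigma T h) ->
     injective Psi).
Proof.
exists (@Psi H I T); split; last exact: Psi_inj.
by move=> z; exists (Phi z); rewrite val_Phi; split=> //; exact: Psi_pi.
Qed.
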